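(* Let $\Delta\cup\{\alpha\}\subseteq L$. Then $\Delta^*\vDash\alpha^*$ in $\mathsf{PPL}$ if and only if $\Delta\vDash_c\alpha$, where $\alpha^*$ is the $\mathsf{PPL}$ formula $\int\alpha=1$ and $\Delta^*=\{\delta^*:\delta\in\Delta\}$.
   Context: $B=\{B_j: j\in\mathbb N\}$ is a denumerable set of propositional symbols and $L$ is the set of propositional formulas generated from $B$ by $\neg$ and $\supset$ (other connectives are the usual abbreviations). A valuation $v:B\to\{0,1\}$ is identified with $\{B_j: v(B_j)=1\}$; $\Vdash_c$ is classical satisfaction; $\Delta\vDash_c\alpha$ means that every valuation satisfying all members of $\Delta$ satisfies $\alpha$. $B_\alpha$ is the set of symbols occurring in $\alpha$ and $[\![\alpha]\!]=\{v\cap B_\alpha : v\Vdash_c\alpha\}$. A stochastic valuation $V$ is a family $\{V_{B_j}\}_{B_j\in B}$ of random variables on a probability space $(\Omega,\mathcal F,\mu)$, where $V_{B_j}$ takes values in $\{\emptyset,\{B_j\}\}$ ($\emptyset$ for false, $\{B_j\}$ for true). For finite non-empty $A\subseteq B$ and $U\subseteq A$, $\mathrm{Prob}(V_A=U)=\mu\big(\bigcap_{B_j\in A}V_{B_j}^{-1}(U\cap\{B_j\})\big)$. For $\alpha\in L$, $\mathrm{Prob}_V(\alpha)=\sum_{U\in[\![\alpha]\!]}\mathrm{Prob}(V_{B_\alpha}=U)$. Formulas of $\mathsf{PPL}$ are generated from atoms $\int\alpha\mathbin{@}p$ (with $\alpha\in L$, $@\in\{=,<\}$, and $p$ a term over $0,1,-,+,\times$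 and variables $x_k$, $k\in\mathbb N$) by the connective $\supset$. For a stochastic valuation $V$ and an assignment $\rho$ of real numbers to variables: $V\rho\Vdash\int\alpha\mathbin{@}p$ iff $\mathrm{Prob}_V(\alpha)\mathbin{@}p^{\mathbb R\rho}$, where $p^{\mathbb R\rho}$ is the value of $p$ in $\mathbb R$ under $\rho$; $V\rho\Vdash\varphi_1\supset\varphi_2$ iff $V\rho\not\Vdash\varphi_1$ or $V\rho\Vdash\varphi_2$. $\Gamma\vDash\varphi$ means that for all $V$ and $\rho$, if $V\rho\Vdash\gamma$ for every $\gamma\in\Gamma$ then $V\rho\Vdash\varphi$. *)

(* Defs.v *)
From mathcomp Require Import all_boot all_order all_algebra finmap.
From mathcomp Require Import all_classical all_reals all_analysis.

Set Implicit Arguments.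
Unset Strict Implicit.
Unset Printing Implicit Defensive.

Import Order.TTheory GRing.Theory Num.Theory.
Local Open Scope classical_set_scope.
Local Open Scope ring_scope.

(* The propositional symbol B_j is represented by its index j. *)
Inductive Lform : Type :=
| Var of nat
| Neg of Lform
| Imp of Lform & Lform.

Definition valuation : Type := nat -> bool.

Fixpoint csat (v : valuation) (a : Lform) : bool :=
  match a with
  | Var j => v j
  | Neg b => ~~ csat v b
  | Imp b c => csat v b ==> csat v c
  end.

Definition centails (Delta : set Lform) (a : Lform) : Prop :=
  forall v : valuation, (forall b, Delta b -> csat v b) -> csat v a.

Fixpoint symbols (a : Lform) : {fset nat} :=
  match a with
  | Var j => [fset j]%fset
  | Neg b => symbols b
  | Imp b c => (symbols b `|` symbols c)%fset
  end.

Definition models (a : Lform) : set {fset nat} :=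
  [set [fset j in symbols a | v j]%fset | v in [set v : valuation | csat v a]].

(* Booleans carry the discrete sigma-algebra; [false] and [true] stand for the
   two values, the empty set and {B_j}, of the j-th random variable. *)
Definition stochastic_valuation (R : realType) (d : measure_display)
  (Omega : measurableType d) (mu : probability Omega R) : Type :=
  nat -> {RV mu >-> bool}.

Definition symval (j : nat) (b : bool) : {fset nat} :=
  (if b then [fset j] else fset0)%fset.

Section Probability.
Context (R : realType) (d : measure_display) (Omega : measurableType d).
Context (mu : probability Omega R) (V : stochastic_valuation mu).

(* Prob(V_A = U), for U a subset of A; [fine] is harmless since mu is finite. *)
Definition prob_at (A U : {fset nat}) : R :=
  fine (mu (\bigcap_(j in [set` A])
    ((fun w => symval j (V j w)) @^-1` [set (U `&` [fset j])%fset]))).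

(* The set [models a] is finite, so this is an ordinary finite sum. *)
Definition prob_form (a : Lform) : R :=
  \sum_(U \in models a) prob_at (symbols a) U.

End Probability.

Inductive PPLterm : Type :=
| TVar of nat
| TZero
| TOne
| TOpp of PPLterm
| TAdd of PPLterm & PPLterm
| TMul of PPLterm & PPLterm.

Fixpoint teval (R : realType) (rho : nat -> R) (p : PPLterm) : R :=
  match p with
  | TVar k => rho k
  | TZero => 0
  | TOne => 1
  | TOpp q => - teval rho q
  | TAdd q r => teval rho q + teval rho r
  | TMul q r => teval rho q * teval rho r
  end.

Inductive cmpsym : Type := CEq | CLt.

Definition cmp_holds (R : realType) (c : cmpsym) (x y : R) : Prop :=
  match c with
  | CEq => x = y
  | CLt => x < y
  end.

Inductive PPLform : Type :=
| PAtom of Lform & cmpsym & PPLterm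
| PImp of PPLform & PPLform.

Fixpoint psat (R : realType) (d : measure_display) (Omega : measurableType d)
    (mu : probability Omega R) (V : stochastic_valuation mu)
    (rho : nat -> R) (f : PPLform) : Prop :=
  match f with
  | PAtom a c p => cmp_holds c (prob_form V a) (teval rho p)
  | PImp g h => ~ psat V rho g \/ psat V rho h
  end.

Definition pentails (R : realType) (Gamma : set PPLform) (f : PPLform) : Prop :=
  forall (d : measure_display) (Omega : measurableType d)
    (mu : probability Omega R) (V : stochastic_valuation mu) (rho : nat -> R),
    (forall g, Gamma g -> psat V rho g) -> psat V rho f.

Definition pstar (a : Lform) : PPLform := PAtom a CEq TOne.

(* Main.v *)
Require Import Defs.
From mathcomp Require Import all_boot all_order all_algebra.
From mathcomp Require Import finmap.
From mathcomp Require Import all_classical all_reals all_analysis.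

(** [prob_form V a] is the measure of the event that the random valuation
    [j |-> V j w] satisfies [a]. If [v] refutes the classical entailment, the
    Dirac measure with the constant random variables [v] refutes the
    probabilistic one. Conversely, [L] is countable, so if every member of
    [Delta] holds almost surely then almost surely all of them hold at once,
    and hence so does [alpha]; no compactness is needed. *)

Local Open Scope classical_set_scope.

(** The trace of [v] on [A], written exactly as the elements of [models] are. *)
Definition true_symbols (A : {fset nat}) (v : valuation) : {fset nat} :=
  [fset j in A | v j]%fset.

Lemma eq_true_symbols (A : {fset nat}) (v1 v2 : valuation) :
  true_symbols A v1 = true_symbols A v2 <-> {in A, v1 =1 v2}.
Proof.
split=> [/fsetP v12 j jA|v12].
  by have := v12 j; rewrite !inE/= jA.
apply/fsetP => j; rewrite !inE/=.
by case: (boolP (j \in A)) => //= jA; exact: v12.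
Qed.

Lemma eq_in_csat (a : Lform) (v1 v2 : valuation) :
  {in symbols a, v1 =1 v2} -> csat v1 a = csat v2 a.
Proof.
elim: a => [j|b IHb|b IHb c IHc] /= v12.
- by apply: v12; rewrite inE.
- by rewrite IHb.
- by rewrite IHb ?IHc// => j js; apply: v12; rewrite inE js ?orbT.
Qed.

(** A valuation with the same trace on [symbols a] may differ from [v] elsewhere, but satisfaction
    of [a] depends only on the symbols of [a]. *)
Lemma true_symbols_models (a : Lform) (v : valuation) :
  models a (true_symbols (symbols a) v) <-> csat v a.
Proof.
split=> [[u ua /eq_true_symbols uv]|va]; last by exists v.
by rewrite -(eq_in_csat a u v uv).
Qed.

Lemma finite_models (a : Lform) : finite_set (models a).
Proof.
apply: (sub_finite_set _ (finite_fset (fpowerset (symbols a)))) => U [v _ <-].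
by rewrite /= fpowersetE; apply/fsubsetP => j; rewrite !inE => /andP[].
Qed.

(** Both sets lie inside the singleton of [j], so only membership of [j] has to be compared. *)
Lemma symval_eq (j : nat) (b : bool) (U : {fset nat}) :
  symval j b = (U `&` [fset j])%fset <-> b = (j \in U).
Proof.
split=> [/fsetP/(_ j)|->].
  by rewrite /symval; case: b; rewrite !inE eqxx andbT.
apply/fsetP => i; rewrite /symval !inE.
by case: ifP => jU; rewrite !inE; case: eqP => [->|]; rewrite ?jU ?andbF.
Qed.

Section Probability.
Context {R : realType} {d : measure_display} {Omega : measurableType d}.
Context {mu : probability Omega R} (V : stochastic_valuation mu).

Definition random_valuation (w : Omega) : valuation := fun j => V j w.

Definition sat_event (a : Lform) : set Omega :=
  [set w | csat (random_valuation w) a].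

Definition cell (A U : {fset nat}) : set Omega :=
  \bigcap_(j in [set` A])
    ((fun w => symval j (V j w)) @^-1` [set (U `&` [fset j])%fset]).

(** Cells are fibres of a single map, the trace of the random valuation on [A]; hence distinct
    traces give disjoint cells. *)
Lemma cellE (A : {fset nat}) (v : valuation) :
  cell A (true_symbols A v) =
  [set w | true_symbols A (random_valuation w) = true_symbols A v].
Proof.
apply/seteqP; split=> w /= Vw.
  apply/eq_true_symbols => j jA.
  by have /symval_eq := Vw j jA; rewrite !inE/= jA.
move=> j jA; apply/symval_eq.
move/eq_true_symbols: Vw => /(_ j jA) Vw.
by rewrite !inE/= (_ : j \in A).
Qed.

Lemma measurable_cell (A U : {fset nat}) : measurable (cell A U).
Proof.
apply: fin_bigcap_measurable; first exact: finite_fset.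
move=> j _.
exact: (@measurable_funPTI _ _ _ _ (V j) (symval j @^-1` [set _])).
Qed.

Lemma sat_event_bigcup (a : Lform) :
  sat_event a = \bigcup_(U in models a) cell (symbols a) U.
Proof.
apply/seteqP; split=> w /=.
  move=> wa; exists (true_symbols (symbols a) (random_valuation w)).
    exact/true_symbols_models.
  by rewrite cellE.
move=> [_ [v va <-]]; rewrite cellE /= => wv.
by apply/true_symbols_models; rewrite wv; exact/true_symbols_models.
Qed.

Lemma measurable_sat_event (a : Lform) : measurable (sat_event a).
Proof.
rewrite sat_event_bigcup; apply: fin_bigcup_measurable => [|U _].
  exact: finite_models.
exact: measurable_cell.
Qed.

(** Finite additivity: the cells of the models of [a] partition [sat_event a]. *)
Lemma prob_formE (a : Lform) : (prob_form V a)%:E = mu (sat_event a).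
Proof.
rewrite sat_event_bigcup measure_fin_bigcup.
- rewrite /prob_form -fsumEFin; last exact: finite_models.
  apply: eq_fsbigr => U _; rewrite /prob_at -/(cell _ _) fineK//.
  exact/fin_num_measure/measurable_cell.
- exact: finite_models.
- move=> _ _ [v1 _ <-] [v2 _ <-] [w []].
  by rewrite !cellE /= => wv1 wv2; rewrite -[LHS]wv1 -[RHS]wv2.
- by move=> U _; exact: measurable_cell.
Qed.

(** Passing to complements turns probability one into null sets, which are stable under countable
    unions. *)
Lemma prob_form_eq1 (a : Lform) :
  prob_form V a = 1%R <-> mu (~` sat_event a) = 0%E.
Proof.
have ma := measurable_sat_event a.
rewrite probability_setC// -prob_formE -EFinB.
split=> [->|[/eqP]]; first by rewrite GRing.subrr.
by rewrite GRing.subr_eq0 => /eqP.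
Qed.

End Probability.

(** An embedding into a countable type, which makes the set of formulas countable. *)
Fixpoint tree_of_Lform (a : Lform) : GenTree.tree nat :=
  match a with
  | Var j => GenTree.Leaf j
  | Neg b => GenTree.Node 0 [:: tree_of_Lform b]
  | Imp b c => GenTree.Node 1 [:: tree_of_Lform b; tree_of_Lform c]
  end.

Lemma tree_of_Lform_inj : injective tree_of_Lform.
Proof.
elim=> [j|b IHb|b IHb c IHc] [j'|b'|b' c'] //= [].
- by move->.
- by move/IHb ->.
- by move=> /IHb -> /IHc ->.
Qed.

Lemma negligible_bigcup_Lform (R : realType) (d : measure_display)
    (Omega : measurableType d) (mu : ({measure set Omega -> \bar R})%R)
    (Delta : set Lform) (N : Lform -> set Omega) :
  (forall b, Delta b -> mu.-negligible (N b)) ->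
  mu.-negligible (\bigcup_(b in Delta) N b).
Proof.
move=> N0; pose code b := choice.pickle (tree_of_Lform b).
(* Regroup the union by code. By injectivity each [n] is the code of at most one formula, so each
   inner union is empty or a single [N b]. *)
apply: (negligibleS (A :=
    \bigcup_n \bigcup_(b in [set b | Delta b /\ code b = n]) N b)).
  by move=> w [b Db Nw]; exists (code b) => //; exists b.
apply: negligible_bigcup => n.
have [[b [Db bn]]|noD] := pselect (exists b, Delta b /\ code b = n).
  apply: negligibleS (N0 b Db) => w [c [Dc cn]].
  suff -> : c = b by [].
  apply: tree_of_Lform_inj; apply: (pcan_inj choice.pickleK).
  by rewrite -/(code c) cn -bn.
rewrite bigcup0; first exact: negligible_set0.
by move=> b Db; case: noD; exists b.
Qed.

Theorem theorem6p2 (R : realType) (Delta : set Lform) (alpha : Lform) :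
  pentails R (pstar @` Delta) (pstar alpha) <-> centails Delta alpha.
Proof.
split=> [Dalpha v vD|Dalpha d Omega mu V rho VD].
  pose mu : probability unit R := @dirac _ unit tt R.
  pose V : stochastic_valuation mu := fun j => cst (v j).
  have Vcst a : prob_form V a = (csat v a)%:R%R.
    apply: EFin_inj; rewrite prob_formE.
    (* The Dirac measure takes the value 1 or 0 on [sat_event a] according to whether its only
       possible point [tt] lies in it. *)
    rewrite [LHS]diracE (_ : (tt \in _) = csat v a)//.
    by apply/idP/idP; rewrite inE.
  have : psat V (fun=> 0%R) (pstar alpha).
    by apply: Dalpha => _ [b Db <-] /=; rewrite Vcst vD.
  by rewrite /= Vcst; case: csat => // /esym/eqP; rewrite GRing.oner_eq0.
apply/prob_form_eq1/measure_negligible.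
  exact/measurableC/measurable_sat_event.
apply: (negligibleS (A := \bigcup_(b in Delta) ~` sat_event V b)).
  (* At a point outside every exceptional set the random valuation satisfies all of [Delta], so
     classical entailment applies to it. *)
  move=> w; apply: contra_notP => Dw; apply: Dalpha => b Db.
  by apply: contrapT => wb; apply: Dw; exists b.
apply: negligible_bigcup_Lform => b Db; apply/negligibleP.
  exact/measurableC/measurable_sat_event.
by apply/prob_form_eq1; apply: (VD (pstar b)); exists b.
Qed.
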